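(* Let $P$ be a UMEL-shellable poset. Then: (i) the Chow polynomial $\underline{\mathrm H}_P(x)$ only has real and nonpositive roots; (ii) the augmented Chow polynomial $\mathrm H_P(x)$ only has real and nonpositive roots.
   Context: All posets are finite, bounded (minimum $\hat 0$, maximum $\hat 1$) and graded with rank function $\mathrm{rk}$, $\mathrm{rk}(\hat 0)=0$; the rank of $P$ is $\mathrm{rk}(\hat 1)$. Write $s\lessdot t$ if $t$ covers $s$, and $\mathcal E(P)$ for the set of covering pairs. UMEL-shellability. An edge labeling is a map $\lambda:\mathcal E(P)\to\Lambda$ to a totally ordered set $(\Lambda,\vartriangleleft)$. It is an EL-labeling if for all $s\le t$ there is a unique maximal chain $s=u_0\lessdot\cdots\lessdot u_k=t$ of $[s,t]$ with weakly increasing labels $\lambda(u_0,u_1)\trianglelefteq\cdots\trianglelefteq\lambda(u_{k-1},u_k)$, and its label sequence is lexicographically minimal among all maximal chains of $[s,t]$. An EL-labeled poset is a pair $(P,\lambda)$ with $\lambda$ an EL-labeling of $P$. For $s\in P$ let $\lambda_1\vartriangleleft\cdots\vartriangleleft\lambda_\ell$ be the distinct labels $\lambda(s,t)$, $t\gtrdot s$ (the labels above $s$). The width is $\omega_s(i)=|\{t: s\lessdot t,\ \lambda(s,t)=\lambda_i\}|$ (equal to $0$ for $i>\ell$). For $s\lessdot t$, $\mathrm{Ind}(s,t)$ is the $i$ with $\lambda(s,t)=\lambda_i$, and $\mathrm{des}_s(t)$ is the number of distinct labels above $t$ that are $\vartriangleleft\lambda(s,t)$. $(P,\lambda)$ is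 a rank-uniform labeled poset if (1) $\omega_s(i)=\omega_{s'}(i)$ for all $s,s'$ of the same rank and all $i\ge1$; and (2) $\mathrm{des}_s(t)=\mathrm{des}_{s'}(t')$ whenever $s\lessdot t$, $s'\lessdot t'$, $\mathrm{rk}(s)=\mathrm{rk}(s')$ and $\mathrm{Ind}(s,t)=\mathrm{Ind}(s',t')$. In that case $\mathrm{des}_k(i)$ denotes $\mathrm{des}_s(t)$ for any $s$ of rank $k$ and $t\gtrdot s$ with $\mathrm{Ind}(s,t)=i$, and $\ell_k$ is the number of distinct labels above any element of rank $k$. It is monotonic if for every $0\le k\le \mathrm{rk}(P)-1$ the function $i\mapsto\mathrm{des}_k(i)$ is weakly increasing on $\{1,\dots,\ell_k\}$. $P$ is UMEL-shellable if it admits an EL-labeling $\lambda$ such that $(P,\lambda)$ is a monotonic rank-uniform labeled poset. Chow polynomials. For $s<t$ let $\chi_{s,t}(x)=\sum_{w\in[s,t]}\mu(s,w)x^{\mathrm{rk}(t)-\mathrm{rk}(w)}$ ($\mu$ the Möbius function) and $\overline\chi_{s,t}(x)=\chi_{s,t}(x)/(x-1)$ (reduced characteristic polynomial). The Chow polynomial is defined recursively by $\underline{\mathrm H}_P(x)=1$ if $|P|=1$ and $\underline{\mathrm H}_P(x)=\sum_{s\in P\setminus\{\hat 0\}}\overline\chi_{\hat 0,s}(x)\,\underline{\mathrm H}_{[s,\hat 1]}(x)$ otherwise. The augmented Chow polynomial is $\mathrm H_P(x)=\sum_{s\in P}x^{\mathrm{rk}(s)}\,\underline{\mathrm H}_{[s,\hat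 1]}(x)$. *)

(* Defs.v *)
From mathcomp Require Import all_boot all_order all_algebra.
From mathcomp Require Import complex.

Set Implicit Arguments.
Unset Strict Implicit.
Unset Printing Implicit Defensive.

Import Order.TTheory GRing.Theory Num.Theory.

Local Open Scope order_scope.

Definition covers (d : Order.disp_t) (P : finTBPOrderType d) : rel P :=
  fun s t => (s < t) && [forall u : P, ~~ ((s < u) && (u < t))].

(* Such a function exists iff P is graded, and it is then unique. *)
Definition rank_function (d : Order.disp_t) (P : finTBPOrderType d)
    (rk : P -> nat) : Prop :=
  rk \bot = 0%N /\ forall s t : P, covers s t -> rk t = (rk s).+1.

(* The maximal chain s = u_0, u_1, ..., u_k = t of [s, t] is encoded by its
   start s and the sequence [:: u_1; ...; u_k]. *)
Definition max_chain (d : Order.disp_t) (P : finTBPOrderType d)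
    (s t : P) (c : seq P) : bool :=
  path (@covers d P) s c && (last s c == t).

(* An edge labeling is a function on all pairs of which only the values on
   covering pairs are ever used below. *)
Definition chain_labels (d d' : Order.disp_t) (P : finTBPOrderType d)
    (L : orderType d') (lam : P -> P -> L) (s : P) (c : seq P) : seqlexi L :=
  pairmap lam s c.

Definition rising (d d' : Order.disp_t) (P : finTBPOrderType d)
    (L : orderType d') (lam : P -> P -> L) (s : P) (c : seq P) : bool :=
  sorted <=%O (chain_labels lam s c : seq L).

Definition EL_labeling (d d' : Order.disp_t) (P : finTBPOrderType d)
    (L : orderType d') (lam : P -> P -> L) : Prop :=
  forall s t : P, s <= t ->
    exists c : seq P,
      [/\ max_chain s t c, rising lam s c,
          forall c' : seq P, max_chain s t c' -> rising lam s c' -> c' = c &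
          forall c' : seq P, max_chain s t c' ->
            chain_labels lam s c <= chain_labels lam s c'].

(* The distinct labels above s, in increasing order. *)
Definition labels_above (d d' : Order.disp_t) (P : finTBPOrderType d)
    (L : orderType d') (lam : P -> P -> L) (s : P) : seq L :=
  sort <=%O (undup [seq lam s t | t <- enum P & covers s t]).

(* Indices are 1-based. *)
Definition Ind (d d' : Order.disp_t) (P : finTBPOrderType d)
    (L : orderType d') (lam : P -> P -> L) (s t : P) : nat :=
  (index (lam s t) (labels_above lam s)).+1.

Definition width (d d' : Order.disp_t) (P : finTBPOrderType d)
    (L : orderType d') (lam : P -> P -> L) (s : P) (i : nat) : nat :=
  #|[set t : P | covers s t && (Ind lam s t == i)]|.

Definition des (d d' : Order.disp_t) (P : finTBPOrderType d)
    (L : orderType d') (lam : P -> P -> L) (s t : P) : nat :=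
  count (fun a => a < lam s t) (labels_above lam t).

Definition rank_uniform (d d' : Order.disp_t) (P : finTBPOrderType d)
    (rk : P -> nat) (L : orderType d') (lam : P -> P -> L) : Prop :=
  (forall (s s' : P) (i : nat), rk s = rk s' -> (1 <= i)%N ->
     width lam s i = width lam s' i) /\
  (forall s t s' t' : P, covers s t -> covers s' t' ->
     rk s = rk s' -> Ind lam s t = Ind lam s' t' ->
     des lam s t = des lam s' t').

(* For a rank-uniform labeling, des_k(i) is des_s(t) for any s of rank k and
   any t covering s with Ind(s, t) = i; monotonicity of i |-> des_k(i) is
   stated for all such representatives. *)
Definition monotonic (d d' : Order.disp_t) (P : finTBPOrderType d)
    (rk : P -> nat) (L : orderType d') (lam : P -> P -> L) : Prop :=
  forall k : nat, (k < rk \top)%N ->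
  forall s t s' t' : P, covers s t -> covers s' t' -> rk s = k -> rk s' = k ->
    (Ind lam s t <= Ind lam s' t')%N -> (des lam s t <= des lam s' t')%N.

Definition UMEL_shellable (d : Order.disp_t) (P : finTBPOrderType d)
    (rk : P -> nat) : Prop :=
  exists (d' : Order.disp_t) (L : orderType d') (lam : P -> P -> L),
    [/\ EL_labeling lam, rank_uniform rk lam & monotonic rk lam].

Local Open Scope ring_scope.

(* The argument n bounds the recursion depth; the recursive equation
   is moebiusE. *)
Fixpoint moebius_rec (d : Order.disp_t) (P : finTBPOrderType d) (n : nat)
    (s t : P) : int :=
  if n is n'.+1 then
    if s == t then 1
    else - \sum_(u : P | ((s <= u) && (u < t))%O) moebius_rec n' s u
  else 0.

Definition moebius (d : Order.disp_t) (P : finTBPOrderType d) (s t : P) : int :=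
  moebius_rec #|P| s t.

Definition char_poly_itv (d : Order.disp_t) (P : finTBPOrderType d)
    (rk : P -> nat) (s t : P) : {poly int} :=
  \sum_(w : P | ((s <= w) && (w <= t))%O) moebius s w *: 'X^(rk t - rk w).

(* For s < t the division by X - 1 is exact: see red_char_polyE. *)
Definition red_char_poly (d : Order.disp_t) (P : finTBPOrderType d)
    (rk : P -> nat) (s t : P) : {poly int} :=
  char_poly_itv rk s t %/ ('X - 1%:P).

(* The argument n bounds the recursion depth; the recursive equation
   is chow_itvE. *)
Fixpoint chow_rec (d : Order.disp_t) (P : finTBPOrderType d) (rk : P -> nat)
    (n : nat) (s t : P) : {poly int} :=
  if n is n'.+1 then
    if s == t then 1
    else \sum_(u : P | ((s < u) && (u <= t))%O)
           red_char_poly rk s u * chow_rec rk n' u t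
  else 0.

(* The Chow polynomial of the interval [s, t]; the rank function of [s, t] is
   rk - rk s, so that it has the same rank differences as P. *)
Definition chow_itv (d : Order.disp_t) (P : finTBPOrderType d) (rk : P -> nat)
    (s t : P) : {poly int} :=
  chow_rec rk #|P| s t.

Definition chow_poly (d : Order.disp_t) (P : finTBPOrderType d)
    (rk : P -> nat) : {poly int} :=
  chow_itv rk \bot%O \top%O.

Definition aug_chow_poly (d : Order.disp_t) (P : finTBPOrderType d)
    (rk : P -> nat) : {poly int} :=
  \sum_(s : P) 'X^(rk s) * chow_itv rk s \top%O.

(* R[i] is the field of complex numbers when R is the field of reals. *)
Definition only_real_nonpos_roots (R : rcfType) (p : {poly int}) : Prop :=
  forall z : R[i], root (map_poly intr p) z ->
    complex.Im z = 0 /\ complex.Re z <= 0.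

Lemma moebius_rec_stable (d : Order.disp_t) (P : finTBPOrderType d)
    (n m : nat) (s t : P) :
  (#|[set u : P | (u < t)%O]| < n)%N -> (#|[set u : P | (u < t)%O]| < m)%N ->
  moebius_rec n s t = moebius_rec m s t.
Proof.
elim: n m t => [//|n IHn] [//|m] t ltn ltm /=.
case: eqP => // _; congr (- _); apply: eq_bigr => u /andP[_ ltut].
have lt_card : (#|[set v : P | (v < u)%O]| < #|[set v : P | (v < t)%O]|)%N.
  apply: proper_card; apply/properP; split.
    by apply/subsetP=> v; rewrite !inE => /lt_trans; apply.
  by exists u; rewrite !inE ?ltxx.
by apply: IHn; apply: leq_trans lt_card _.
Qed.

Lemma card_lt (d : Order.disp_t) (P : finTBPOrderType d) (t : P) :
  (#|[set u : P | (u < t)%O]| < #|P|)%N.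
Proof.
rewrite -cardsT; apply: proper_card; rewrite properT.
by apply/eqP=> /setP/(_ t); rewrite !inE ltxx.
Qed.

Lemma card_gt (d : Order.disp_t) (P : finTBPOrderType d) (s : P) :
  (#|[set u : P | (s < u)%O]| < #|P|)%N.
Proof.
rewrite -cardsT; apply: proper_card; rewrite properT.
by apply/eqP=> /setP/(_ s); rewrite !inE ltxx.
Qed.

Lemma moebiusE (d : Order.disp_t) (P : finTBPOrderType d) (s t : P) :
  moebius s t =
  if s == t then 1 else - \sum_(u : P | ((s <= u) && (u < t))%O) moebius s u.
Proof.
rewrite /moebius (@moebius_rec_stable _ _ _ #|P|.+1) ?ltnS ?card_lt //.
by rewrite ltnW ?card_lt.
Qed.

Lemma chow_rec_stable (d : Order.disp_t) (P : finTBPOrderType d)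
    (rk : P -> nat) (n m : nat) (s t : P) :
  (#|[set u : P | (s < u)%O]| < n)%N -> (#|[set u : P | (s < u)%O]| < m)%N ->
  chow_rec rk n s t = chow_rec rk m s t.
Proof.
elim: n m s => [//|n IHn] [//|m] s ltn ltm /=.
case: eqP => // _; apply: eq_bigr => u /andP[ltsu _]; congr (_ * _).
have lt_card : (#|[set v : P | (u < v)%O]| < #|[set v : P | (s < v)%O]|)%N.
  apply: proper_card; apply/properP; split.
    by apply/subsetP=> v; rewrite !inE; apply: lt_trans.
  by exists u; rewrite !inE ?ltxx.
by apply: IHn; apply: leq_trans lt_card _.
Qed.

Lemma chow_itvE (d : Order.disp_t) (P : finTBPOrderType d) (rk : P -> nat)
    (s t : P) :
  chow_itv rk s t =
  if s == t then 1
  else \sum_(u : P | ((s < u) && (u <= t))%O)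
         red_char_poly rk s u * chow_itv rk u t.
Proof.
rewrite /chow_itv (@chow_rec_stable _ _ _ _ #|P|.+1) ?ltnS ?card_gt //.
by rewrite ltnW ?card_gt.
Qed.

Lemma red_char_polyE (d : Order.disp_t) (P : finTBPOrderType d)
    (rk : P -> nat) (s t : P) :
  (s < t)%O -> red_char_poly rk s t * ('X - 1%:P) = char_poly_itv rk s t.
Proof.
move=> ltst; apply/esym/eqP.
rewrite /red_char_poly -Pdiv.IdomainMonic.dvdp_eq ?monicXsubC //.
rewrite dvdp_XsubCl; apply/rootP; rewrite /char_poly_itv horner_sum.
under eq_bigr do rewrite hornerZ hornerXn expr1n mulr1.
rewrite (bigD1 t) /=; last by rewrite lexx andbT ltW.
rewrite moebiusE lt_eqF //; apply/eqP; rewrite addrC subr_eq0; apply/eqP.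
by apply: eq_bigl => u; rewrite -andbA [in RHS]lt_neqAle [(u <= t)%O && _]andbC.
Qed.

(* Main.v *)
Require Import Defs.
From mathcomp Require Import all_boot all_order all_algebra.
From mathcomp Require Import complex ring zify.

Set Implicit Arguments.
Unset Strict Implicit.
Unset Printing Implicit Defensive.

Import Order.TTheory GRing.Theory Num.Theory.

Local Open Scope ring_scope.

(** Write [H s] for the Chow polynomial of the interval from [s] to the
    maximum.  Moebius inversion of its defining recursion leaves
      H s = 1 + sum over u > s of (x + ... + x^(r-1)) H u,  r = rk u - rk s
    (lemma [chow_up_rec]), in which the Moebius function no longer occurs.

    In an EL-labeled poset every [u > s] is reached from [s] by exactly one
    rising chain.  Sorting the sum above by the first step of that chain turns
    it into a transfer recursion along the edges of the Hasse diagram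
    ([asc_sum_rec], [desc_sum_rec]) that only sees whether consecutive labels
    ascend or descend.  Unfolded, it says that the Chow polynomial of a poset
    of rank [n] is the sum of x^des (1+x)^(n-1-2des) over the maximal chains
    whose labels neither begin with a descent nor have two consecutive descents;
    for the augmented polynomial the first position may be a descent and the
    exponent is n-2des.

    Up to a power of 1+x these are polynomials in t = x/(1+x)^2, and their
    real-rootedness comes from interlacing: the polynomials attached to the
    edges that start at a given rank, ordered by the index of the label, form
    interlacing families, because rank-uniformity makes the recursion the same
    above all elements of a rank and monotonicity of des orders the thresholds
    at which its sums are cut.

    The interlacing argument is carried out at a single complex number [z] that
    is not a nonpositive real.  Then t = z/(1+z)^2 is not one either
    ([t_notin]), so the numbers al + be t with al, be >= 0 form a convex cone
    without lines.  If f and g are real polynomials with nonnegative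
    coefficients and nonpositive zeros and f interlaces g, the quotient
    g(t)/f(t) lies in this cone.  The relation [ilace] keeps only this: it asks
    that g times the conjugate of f lie in the cone, which is additive in f and
    in g, is preserved by the recursion ([edge_vals_ilace]), and prevents a sum
    of mutually related numbers from vanishing unless they all vanish
    ([ilace_sum_neq0]).  Hence neither Chow polynomial vanishes at [z]. *)

(** * Moebius inversion *)

Section PosetInduction.

Variables (d : Order.disp_t) (P : finTBPOrderType d).

Lemma gt_ind (Q : P -> Prop) :
  (forall s, (forall u, (s < u)%O -> Q u) -> Q s) -> forall s, Q s.
Proof.
move=> IH s; have [n le_n] := ubnP #|[set u | (s < u)%O]|.
elim: n s le_n => // n IHn s /ltnSE le_n; apply: IH => u ltsu; apply: IHn.
apply: leq_trans le_n; apply: proper_card; apply/properP; split.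
  by apply/subsetP => v; rewrite !inE; apply: lt_trans.
by exists u; rewrite !inE ?ltxx.
Qed.

Lemma sum_ge_split (V : nmodType) (F : P -> V) s :
  \sum_(u | (s <= u)%O) F u = F s + \sum_(u | (s < u)%O) F u.
Proof.
rewrite (bigD1 s) //=; congr (_ + _).
by apply: eq_bigl => u; rewrite lt_neqAle andbC eq_sym.
Qed.

Lemma sum_ge_top (V : nmodType) (F : P -> V) :
  \sum_(u | (\top <= u)%O) F u = F \top%O.
Proof. by apply: big_pred1 => u /=; rewrite le1x. Qed.

(** The defining recursion of the Moebius function says that it is a right
    inverse of the zeta function. *)
Lemma sum_moebius (s t : P) :
  \sum_(u | (s <= u)%O && (u <= t)%O) moebius s u = (s == t)%:R.
Proof.
have [<-|neq_st] := eqVneq s t.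
  by rewrite (big_pred1 s) => [|u /=]; rewrite ?moebiusE ?eqxx // -eq_le eq_sym.
have [le_st|nle_st] := boolP (s <= t)%O; last first.
  rewrite big_pred0 // => u; apply/negP => /andP[su ut].
  by rewrite (le_trans su ut) in nle_st.
rewrite (bigD1 t) /= ?le_st ?lexx // moebiusE (negPf neq_st).
rewrite [X in _ + X](eq_bigl (fun u => (s <= u)%O && (u < t)%O)) ?addNr // => u.
by rewrite lt_neqAle -andbA [(u != t) && _]andbC.
Qed.

(** The matrix of the Moebius function is unitriangular, hence injective. *)
Lemma moebius_inj (V : P -> {poly int}) :
  (forall s, \sum_(w | (s <= w)%O) moebius s w *: V w = 0) -> forall s, V s = 0.
Proof.
move=> V0; apply: gt_ind => s IH; have := V0 s.
rewrite sum_ge_split moebiusE eqxx scale1r big1 ?addr0 // => u /IH ->.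
by rewrite scaler0.
Qed.

End PosetInduction.

Section ChowRecursion.

Variables (d : Order.disp_t) (P : finTBPOrderType d) (rk : P -> nat).

Definition geom (R : pzSemiRingType) (x : R) (n : nat) : R :=
  \sum_(i < n) x ^+ i.+1.

Definition chow_up (s : P) : {poly int} := chow_itv rk s \top%O.

Lemma chow_up_top : chow_up \top%O = 1.
Proof. by rewrite /chow_up chow_itvE eqxx. Qed.

Lemma exchange_chain (V : nmodType) (F : P -> P -> V) s :
  \sum_(w | (s <= w)%O) \sum_(u | (w <= u)%O) F w u =
  \sum_(u | (s <= u)%O) \sum_(w | (s <= w)%O && (w <= u)%O) F w u.
Proof.
rewrite (exchange_big_dep (fun u => (s <= u)%O)) //= => w u; exact: le_trans.
Qed.

(** The recursion with the division by 'X - 1 cleared and the term u = s, where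
    the characteristic polynomial is 1, included. *)
Lemma char_poly_chow (s : P) :
  \sum_(u | (s <= u)%O) char_poly_itv rk s u * chow_up u =
  'X * chow_up s + (1 - 'X) * (s == \top%O)%:R.
Proof.
rewrite sum_ge_split.
have -> : char_poly_itv rk s s = 1.
  rewrite /char_poly_itv (big_pred1 s) => [|w /=];
    last by rewrite eq_sym -eq_le.
  by rewrite moebiusE eqxx scale1r subnn.
have [->|neq_s] := eqVneq s \top%O.
  by rewrite chow_up_top !mulr1 big_pred0 ?addr0 ?subrKC // => u; rewrite lt1x.
have -> : \sum_(u | (s < u)%O) char_poly_itv rk s u * chow_up u =
   ('X - 1) * chow_up s.
  rewrite [in RHS]/chow_up chow_itvE (negPf neq_s) mulr_sumr.
  apply: eq_big => u; first by rewrite lex1 andbT.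
  by move=> su; rewrite -red_char_polyE // polyC1 mulrA [_ * red_char_poly _ _ _]mulrC.
rewrite mulr0; ring.
Qed.

Hypothesis rk_lt : forall s u : P, (s < u)%O -> (rk s < rk u)%N.

(** Applying the Moebius matrix to both sides gives [char_poly_chow], which is
    the defining recursion; so the two sides agree because that matrix is
    injective.  In words: the augmented Chow polynomial of an upper interval is
    x times the sum of all [chow_up u], plus 1 - x. *)
Lemma chow_zeta (s : P) :
  \sum_(u | (s <= u)%O) ('X^(rk u - rk s) - 'X) * chow_up u = 1 - 'X.
Proof.
pose V (w : P) := \sum_(u | (w <= u)%O) ('X^(rk u - rk w) - 'X) * chow_up u
             - (1 - 'X).
suff V0 : forall w, V w = 0 by apply/eqP; rewrite -subr_eq0; apply/eqP/(V0 s).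
apply: moebius_inj => {}s; rewrite /V.
under eq_bigr do rewrite scalerBr scaler_sumr.
rewrite sumrB exchange_chain -scaler_suml.
have -> : \sum_(w | (s <= w)%O) moebius s w = (s == \top%O)%:R.
  rewrite -sum_moebius; apply: eq_bigl => u; by rewrite lex1 andbT.
under eq_bigr => u su.
  under eq_bigr do rewrite mulrBl scalerBr [X in X - _]scalerAl.
  rewrite sumrB -mulr_suml -scaler_suml sum_moebius.
  over.
have kronecker : \sum_(u | (s <= u)%O) (s == u)%:R *: ('X * chow_up u) =
    'X * chow_up s :> {poly int}.
  rewrite (bigD1 s) //= eqxx scale1r big1 ?addr0 // => u /andP[_ /negPf].
  by rewrite eq_sym => ->; rewrite scale0r.
rewrite sumrB char_poly_chow kronecker.
by rewrite scaler_nat; case: (s == _); rewrite ?mulr1n ?mulr0n ?mulr1 ?mulr0;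
  ring.
Qed.

(** [chow_zeta] solved for its term u = s, after division by 'X - 1. *)
Lemma chow_up_rec (s : P) :
  chow_up s = 1 + \sum_(u | (s < u)%O) geom 'X (rk u - rk s).-1 * chow_up u.
Proof.
have X1 : ('X - 1 : {poly int}) != 0 by rewrite -polyC1 polyXsubC_eq0.
apply: (mulfI X1); have := chow_zeta s; rewrite sum_ge_split subnn expr0.
rewrite mulrDr mulr1 mulr_sumr.
under eq_bigr => u su.
  have -> : 'X^(rk u - rk s) - 'X = ('X - 1) * geom 'X (rk u - rk s).-1 :> {poly int}.
    have := rk_lt su; rewrite -subn_gt0; case: (rk u - rk s)%N => //= n _.
    rewrite /geom; under eq_bigr do rewrite exprS.
    by rewrite -mulr_sumr mulrCA -subrX1 exprS; ring.
  rewrite -mulrA; over.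
by move=> E; rewrite -[X in _ = X + _]opprB -E; ring.
Qed.

End ChowRecursion.

(** * Rising chains *)

Section RisingSteps.

Variables (d d' : Order.disp_t) (P : finTBPOrderType d).
Variables (L : orderType d') (lam : P -> P -> L).

Lemma covers_lt (s t : P) : covers s t -> (s < t)%O.
Proof. by case/andP. Qed.

Lemma covers_between (s u v : P) :
  covers s v -> (s < u)%O -> (u <= v)%O -> u = v.
Proof.
case/andP=> _ /forallP/(_ u) + su; rewrite su /= le_eqVlt => /negPf ->.
by rewrite orbF => /eqP.
Qed.

Lemma path_covers_le (s : P) (c : seq P) :
  path (@covers d P) s c -> (s <= last s c)%O.
Proof.
elim: c s => //= u c IH s /andP[/covers_lt/ltW su /IH]; exact: le_trans.
Qed.

(** [step s v] is meant to be the first element after [s] of the rising chain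
    from [s] to [v].  The second clause expresses both existence and uniqueness
    of rising chains: the rising chain from [s] to [v] goes through the cover
    [u] exactly when the rising chain from [u] to [v] can be extended by [s]
    without creating a descent.  The third is lexicographic minimality for
    the first step towards the maximum. *)
Definition rising_step (step : P -> P -> P) : Prop :=
  [/\ forall s v, (s < v)%O -> covers s (step s v) && (step s v <= v)%O,
      forall s u v, covers s u -> (u < v)%O ->
        (step s v == u) = (lam s u <= lam u (step u v))%O &
      forall s u, covers s u -> (lam s (step s \top) <= lam s u)%O].

Lemma EL_rising_step : EL_labeling lam -> exists step, rising_step step.
Proof.
move=> EL.
pose starts (s v u : P) := exists c,
  [/\ max_chain s v (u :: c), rising lam s (u :: c) &
      forall c', max_chain s v c' ->
        (chain_labels lam s (u :: c) <= chain_labels lam s c')%O].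
have ex_start (p : P * P) : exists u, (p.1 < p.2)%O -> starts p.1 p.2 u.
  case: p => s v /=; have [sv|nsv] := boolP (s < v)%O; last by exists s.
  have [[|u c] [cv ris _ lex]] := EL s v (ltW sv).
    by move: cv; rewrite /max_chain /= lt_eqF.
  by exists u => _; exists c.
have [f fP] := fin_all_exists ex_start.
have start_uniq s v u u' c c' : max_chain s v (u :: c) -> rising lam s (u :: c) ->
    max_chain s v (u' :: c') -> rising lam s (u' :: c') -> u :: c = u' :: c'.
  move=> m r m' r'.
  have sv : (s <= v)%O.
    by case/andP: m => /path_covers_le + /eqP E; rewrite E.
  have [c0 [_ _ uq _]] := EL s v sv.
  by rewrite (uq _ m r) (uq _ m' r').
exists (fun s v => f (s, v)); split.
- move=> s v sv; have [c [/andP[/= /andP[-> pc] /eqP lc] _ _]] := fP (s, v) sv.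
  by rewrite -[X in (_ <= X)%O]lc; exact: path_covers_le pc.
- move=> s u v su uv.
  have [c [mc rc _]] := fP (u, v) uv.
  have [c' [mc' rc' _]] := fP (s, v) (lt_trans (covers_lt su) uv).
  set w := f (u, v) in mc rc *; set u' := f (s, v) in mc' rc' *.
  apply/eqP/idP => [E|le_l].
    rewrite E in mc' rc'; case: c' mc' rc' => [|w' c'] mc' rc'.
      by move: mc'; rewrite /max_chain /= lt_eqF ?andbF.
    case/andP: mc' => /= /andP[_ pc'] lc'.
    case/andP: rc' => /= le_l rc'.
    have [-> _] : w :: c = w' :: c' by apply: (start_uniq u v);
      rewrite // /max_chain /= pc'.
    exact: le_l.
  have [-> //] : u' :: c' = [:: u, w & c].
  apply: (start_uniq s v) => //.
    by rewrite /max_chain /= su; exact: mc.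
  by rewrite /rising /= le_l; exact: rc.
- move=> s u su; have [c [_ _ lex]] := fP (s, \top%O) (lt_le_trans (covers_lt su) (lex1 _)).
  have [c' [mc' _ _ _]] := EL u \top%O (lex1 _).
  have: max_chain s \top%O (u :: c') by rewrite /max_chain /= su; exact: mc'.
  by move/lex; rewrite /chain_labels /= lexi_cons => /andP[].
Qed.

End RisingSteps.

(** * Sums over the chains through an edge *)

Section EdgeSums.

Variables (d d' : Order.disp_t) (P : finTBPOrderType d) (rk : P -> nat).
Variables (L : orderType d') (lam : P -> P -> L) (step : P -> P -> P).
Hypotheses (rkP : rank_function rk) (stepP : rising_step lam step).

Lemma step_covers (s v : P) : (s < v)%O -> covers s (step s v).
Proof. by case: stepP => st _ _ /st /andP[]. Qed.

Lemma step_le (s v : P) : (s < v)%O -> (step s v <= v)%O.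
Proof. by case: stepP => st _ _ /st /andP[]. Qed.

Lemma step_cover (s u : P) : covers s u -> step s u = u.
Proof.
move=> su; have lsu := covers_lt su.
by apply: (covers_between su (covers_lt (step_covers lsu)) (step_le lsu)).
Qed.

Lemma rk_covers (s u : P) : covers s u -> rk u = (rk s).+1.
Proof. by case: rkP => _; apply. Qed.

Lemma rk_lt (s u : P) : (s < u)%O -> (rk s < rk u)%N.
Proof.
elim/(@gt_ind _ P): s => s IH su; have sw := step_covers su.
have := step_le su; rewrite le_eqVlt => /predU1P[<-|wu].
  by rewrite (rk_covers sw).
by have := IH _ (covers_lt sw) wu; rewrite (rk_covers sw); apply: leq_trans.
Qed.

Lemma rk_le (s u : P) : (s <= u)%O -> (rk s <= rk u)%N.
Proof. by rewrite le_eqVlt => /predU1P[->//|/rk_lt/ltnW]. Qed.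

(** This and the next lemma follow the rising chain from [s] to [v] for its first
    and for its second step. *)
Lemma sum_first_step (V : nmodType) (F : P -> V) (s : P) :
  \sum_(v | (s < v)%O) F v =
  \sum_(u | covers s u) \sum_(v | (u <= v)%O && (step s v == u)) F v.
Proof.
rewrite (partition_big (step s) (@covers d P s)) => [|v];
  last exact: step_covers.
apply: eq_bigr => u su; apply: eq_bigl => v.
have [E|] := eqVneq (step s v) u; rewrite ?andbF // !andbT.
apply/idP/idP => [sv|]; first by rewrite -E step_le.
exact: lt_le_trans (covers_lt su).
Qed.

Lemma sum_next_step (V : nmodType) (F : P -> V) (s u : P) : covers s u ->
  \sum_(v | (u <= v)%O && (step s v == u)) F v =
  F u + \sum_(w | covers u w && (lam s u <= lam u w)%O)
          \sum_(v | (w <= v)%O && (step u v == w)) F v.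
Proof.
move=> su; rewrite (bigD1 u) /=; last by rewrite lexx step_cover ?eqxx.
congr (_ + _).
have ltE v : ((u <= v)%O && (step s v == u)) && (v != u) =
    (u < v)%O && (lam s u <= lam u (step u v))%O.
  rewrite andbAC; have -> : (u <= v)%O && (v != u) = (u < v)%O.
    by rewrite [RHS]lt_neqAle eq_sym andbC.
  by have [uv|//] := boolP (u < v)%O; case: stepP => _ -> //.
rewrite (eq_bigl _ _ ltE).
rewrite (partition_big (step u) (fun w => covers u w && (lam s u <= lam u w)%O)).
  apply: eq_bigr => w /andP[uw le_l]; apply: eq_bigl => v.
  have [E|] := eqVneq (step u v) w; rewrite ?andbF // !andbT E le_l andbT.
  apply/idP/idP => [uv|]; first by rewrite -E step_le.
  exact: lt_le_trans (covers_lt uw).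
by move=> v /andP[uv le_l]; rewrite step_covers.
Qed.

Variables (C : comNzRingType) (x : C) (h : P -> C).
Hypothesis h_rec : forall s : P,
  h s = 1 + \sum_(u | (s < u)%O) geom x (rk u - rk s).-1 * h u.

(** The next three sums run over the elements [v] whose rising chain from [s]
    starts with the edge [(s, u)].  When [h] is the Chow polynomial, [asc_sum]
    is the weight of all ways to continue this edge to a maximal chain without
    descent at [u], [desc_sum] is that of the continuations with a descent at
    [u] (the factor x of this descent being left out), and continuations with
    two consecutive descents are discarded.  Defining the sums by closed
    formulas rather than by the recursion they satisfy makes the recursion a
    direct consequence of [sum_next_step]. *)
Definition tail_sum (s u : P) : C :=
  \sum_(v | (u <= v)%O && (step s v == u)) x ^+ (rk v - rk u) * h v.

Definition asc_sum (s u : P) : C := (step s \top%O == u)%:R +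
  \sum_(v | (u <= v)%O && (step s v == u)) geom x (rk v - rk u) * h v.

Definition desc_sum (s u : P) : C := tail_sum s u - asc_sum s u.

Lemma sum_eq_nat (Q : pred P) (w : P) :
  \sum_(u | Q u) (w == u)%:R = (Q w)%:R :> C.
Proof.
have [Qw|nQw] := boolP (Q w).
  rewrite (bigD1 w) //= eqxx big1 ?addr0 // => u /andP[_ /negPf].
  by rewrite eq_sym => ->.
by rewrite big1 // => u Qu; case: eqP => // E; rewrite E Qu in nQw.
Qed.

(** With r = rk v - rk s, the factor x + ... + x^(r-1) in the recursion of [h] is
    the one that [v] gets in [asc_sum s u], because rk u = rk s + 1. *)
Lemma sum_asc_sum (s : P) : s != \top%O -> h s = \sum_(u | covers s u) asc_sum s u.
Proof.
move=> s1; rewrite h_rec sum_first_step big_split /= sum_eq_nat.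
rewrite step_covers ?lt_neqAle ?s1 ?lex1 //; congr (_ + _).
apply: eq_bigr => u su; apply: eq_bigr => v /andP[uv _].
by rewrite (rk_covers su) subnS.
Qed.

Lemma h_top : h \top%O = 1.
Proof. by rewrite h_rec big_pred0 ?addr0 // => u; rewrite lt1x. Qed.

Lemma tail_sum_rec (s u : P) : covers s u -> tail_sum s u =
  h u + x * \sum_(w | covers u w && (lam s u <= lam u w)%O) tail_sum u w.
Proof.
move=> su; rewrite /tail_sum sum_next_step // subnn expr0 mul1r; congr (_ + _).
rewrite mulr_sumr; apply: eq_bigr => w /andP[uw _]; rewrite mulr_sumr.
apply: eq_bigr => v /andP[wv _]; rewrite mulrA -exprS; congr (x ^+ _ * _).
by have := rk_le wv; rewrite (rk_covers uw); lia.
Qed.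

Lemma asc_sum_top (s : P) : covers s \top%O -> asc_sum s \top%O = 1.
Proof.
move=> s1; rewrite /asc_sum step_cover // eqxx big1 ?addr0 // => v.
by rewrite le1x => /andP[/eqP -> _]; rewrite subnn /geom big_ord0 mul0r.
Qed.

Lemma desc_sum_top (s : P) : covers s \top%O -> desc_sum s \top%O = 0.
Proof.
move=> s1; rewrite /desc_sum asc_sum_top // tail_sum_rec // h_top big_pred0 => [|w].
  by ring.
by apply/negP => /andP[/covers_lt]; rewrite lt1x.
Qed.

(** The constant term of [asc_sum] moves along the rising chain to the maximum,
    and x + ... + x^(m+1) exceeds x + ... + x^m by the factor x * x^m that
    [v] gets in x * [tail_sum]. *)
Lemma asc_sum_tail_rec (s u : P) : covers s u -> u != \top%O -> asc_sum s u =
  \sum_(w | covers u w && (lam s u <= lam u w)%O) (asc_sum u w + x * tail_sum u w).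
Proof.
move=> su u1; have lu1 : (u < \top)%O by rewrite lt_neqAle u1 lex1.
rewrite /asc_sum sum_next_step // subnn /geom big_ord0 mul0r add0r.
under [RHS]eq_bigr do rewrite -addrA.
rewrite [RHS]big_split /= sum_eq_nat step_covers //=.
case: (stepP) => _ -> // _; congr (_ + _); apply: eq_bigr => w /andP[uw _].
rewrite /tail_sum mulr_sumr -big_split; apply: eq_bigr => v /andP[wv _] /=.
have -> : (rk v - rk u = (rk v - rk w).+1)%N.
  by have := rk_le wv; rewrite (rk_covers uw); lia.
by rewrite big_ord_recr /= exprS; ring.
Qed.

Lemma asc_sum_rec (s u : P) : covers s u -> u != \top%O -> asc_sum s u =
  \sum_(w | covers u w && (lam s u <= lam u w)%O)
    ((1 + x) * asc_sum u w + x * desc_sum u w).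
Proof.
move=> su u1; rewrite asc_sum_tail_rec //; apply: eq_bigr => w _.
by rewrite /desc_sum; ring.
Qed.

(** The sum of [asc_sum u w] over all [w] that is contained in [tail_sum s u] as
    [h u] loses its ascending part to [asc_sum s u]. *)
Lemma desc_sum_rec (s u : P) : covers s u -> u != \top%O -> desc_sum s u =
  \sum_(w | covers u w && (lam u w < lam s u)%O) asc_sum u w.
Proof.
move=> su u1; rewrite /desc_sum tail_sum_rec // sum_asc_sum // asc_sum_tail_rec //.
rewrite [X in _ - X]big_split /= (bigID (fun w => (lam s u <= lam u w)%O)) /=.
rewrite mulr_sumr.
rewrite [X in _ + X + _ - _](eq_bigl (fun w => covers u w && (lam u w < lam s u)%O)).
  by ring.
by move=> w; rewrite -ltNge.
Qed.

Lemma aug_tail_sum (s : P) :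
  \sum_(v | (s <= v)%O) x ^+ (rk v - rk s) * h v =
  h s + x * \sum_(u | covers s u) tail_sum s u.
Proof.
rewrite sum_ge_split subnn expr0 mul1r sum_first_step; congr (_ + _).
rewrite mulr_sumr; apply: eq_bigr => u su; rewrite mulr_sumr.
apply: eq_bigr => v /andP[uv _]; rewrite mulrA -exprS; congr (x ^+ _ * _).
by have := rk_le uv; rewrite (rk_covers su); lia.
Qed.

Lemma aug_edge_sum (s : P) : s != \top%O ->
  \sum_(v | (s <= v)%O) x ^+ (rk v - rk s) * h v =
  \sum_(u | covers s u) ((1 + x) * asc_sum s u + x * desc_sum s u).
Proof.
move=> s1; rewrite aug_tail_sum sum_asc_sum // mulr_sumr -big_split.
by apply: eq_bigr => u _; rewrite /desc_sum /=; ring.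
Qed.

End EdgeSums.

(** * Interlacing at a point *)

Section Cone.

Variables (C : numClosedFieldType) (t : C).

(** For t outside the nonpositive reals, the closed sector between the
    directions of 1 and of t. *)
Definition cone (w : C) : Prop :=
  exists al be : C, [/\ 0 <= al, 0 <= be & w = al + be * t].

Lemma cone_ge0 w : 0 <= w -> cone w.
Proof. by move=> w0; exists w, 0; rewrite mul0r addr0 lexx. Qed.

Lemma coneD w w' : cone w -> cone w' -> cone (w + w').
Proof.
move=> [al [be [al0 be0 ->]]] [al' [be' [al'0 be'0 ->]]].
by exists (al + al'), (be + be'); split; rewrite ?addr_ge0 //; ring.
Qed.

Lemma cone_sum (I : finType) (Q : pred I) (w : I -> C) :
  (forall i, Q i -> cone (w i)) -> cone (\sum_(i | Q i) w i).
Proof. by apply: big_ind; [apply: cone_ge0|apply: coneD]. Qed.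

Lemma cone_scale k w : 0 <= k -> cone w -> cone (k * w).
Proof.
move=> k0 [al [be [al0 be0 ->]]].
by exists (k * al), (k * be); split; rewrite ?mulr_ge0 //; ring.
Qed.

(** Reflection in the bisector of the sector, up to a positive factor. *)
Lemma cone_flip w : cone w -> cone (t * w^*).
Proof.
move=> [al [be [al0 be0 ->]]]; exists (be * (t * t^*)), al.
rewrite mulr_ge0 ?mul_conjC_ge0 //; split=> //.
by rewrite rmorphD rmorphM /= (geC0_conj al0) (geC0_conj be0); ring.
Qed.

(** The quotient g / f lies in the sector: the trace at the point t of f
    interlacing g.  The product with the conjugate avoids division by 0 and makes
    the relation additive on both sides. *)
Definition ilace (f g : C) : Prop := cone (g * f^*).

Lemma ilace_refl f : ilace f f.
Proof. exact/cone_ge0/mul_conjC_ge0. Qed.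

(** If f interlaces g and all zeros are nonpositive, then g interlaces 'X * f. *)
Lemma ilace_flip f g : ilace f g -> ilace g (t * f).
Proof.
move=> /cone_flip; rewrite /ilace rmorphM /= conjCK.
by rewrite [g^* * f]mulrC mulrA.
Qed.

Lemma ilace_scale k f g : ilace f g -> ilace (k * f) (k * g).
Proof.
move=> /(cone_scale (mul_conjC_ge0 k)); rewrite /ilace rmorphM.
by congr cone; ring.
Qed.

Lemma ilaceDl f f' g : ilace f g -> ilace f' g -> ilace (f + f') g.
Proof. by rewrite /ilace rmorphD mulrDr; apply: coneD. Qed.

Lemma ilaceDr f g g' : ilace f g -> ilace f g' -> ilace f (g + g').
Proof. by rewrite /ilace mulrDl; apply: coneD. Qed.

Lemma ilace_sum (I J : finType) (Q : pred I) (S : pred J) (f : I -> C) (g : J -> C) :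
  (forall i j, Q i -> S j -> ilace (f i) (g j)) ->
  ilace (\sum_(i | Q i) f i) (\sum_(j | S j) g j).
Proof.
move=> fg; rewrite /ilace mulr_suml; apply: cone_sum => j Sj.
rewrite rmorph_sum mulr_sumr; apply: cone_sum => i Qi; exact: fg.
Qed.

(** One step of the transfer recursion.  The index set stands for the edges above
    an element, [ind] for the index of their labels, [a] and [b] for the two
    values of an edge according to whether an ascent or a descent follows; [D]
    is the number of labels above this element that make a descent with the
    label below it. *)
Section Transfer.

Variables (I : finType) (Q : pred I) (ind : I -> nat) (a b : I -> C).
Let c i := a i + t * b i.
Hypothesis ba : forall i j, Q i -> Q j -> ilace (b i) (a j).
Hypothesis aa : forall i j, Q i -> Q j -> (ind i <= ind j)%N -> ilace (a i) (a j).
Hypothesis cc : forall i j, Q i -> Q j -> (ind i <= ind j)%N -> ilace (c i) (c j).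

Definition low_sum D := \sum_(i | Q i && (ind i <= D)%N) a i.
Definition high_sum D := \sum_(i | Q i && (D < ind i)%N) (a i + t * b i).

(** The summands [t * b j] on the right are above every [a i] by [ba].  For the
    summands [a j], whichever of D and D' is larger, the indices that the two
    sums have in common contribute the same sum to both sides, and the others
    are in increasing order from left to right. *)
Lemma low_high_ilace D D' : ilace (low_sum D) (high_sum D').
Proof.
rewrite /high_sum big_split /=; apply: ilaceDr; last first.
  by apply: ilace_sum => i j /andP[Qi _] /andP[Qj _]; apply/ilace_flip/ba.
rewrite /low_sum (bigID (fun i => (D' < ind i)%N)) /=.
rewrite [X in ilace _ X](bigID (fun i => (ind i <= D)%N)) /=.
rewrite addrC; apply: ilaceDl.
  apply: ilaceDr; apply: ilace_sum => i j /andP[/andP[Qi le_i] le_i'];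
    move=> /andP[/andP[Qj le_j] le_j']; apply: aa => //; lia.
apply: ilaceDr.
  rewrite [X in ilace _ X](eq_bigl (fun i => Q i && (ind i <= D)%N && (D' < ind i)%N)).
    exact: ilace_refl.
  by move=> i; rewrite andbAC.
apply: ilace_sum => i j /andP[/andP[Qi le_i] le_i'];
  move=> /andP[/andP[Qj le_j] le_j']; apply: aa => //; lia.
Qed.

Lemma high_sum_split D D' : (D <= D')%N ->
  high_sum D = \sum_(i | Q i && (D < ind i <= D')%N) c i + high_sum D'.
Proof.
move=> leD; rewrite /high_sum (bigID (fun i => (ind i <= D')%N)) /=.
congr (_ + _); apply: eq_bigl => i; first by rewrite andbA.
rewrite -andbA; congr (_ && _); lia.
Qed.

Lemma low_sum_split D D' : (D <= D')%N ->
  low_sum D' = low_sum D + \sum_(i | Q i && (D < ind i <= D')%N) a i.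
Proof.
move=> leD; rewrite /low_sum (bigID (fun i => (ind i <= D)%N)) /=.
congr (_ + _); apply: eq_bigl => i; rewrite -andbA; congr (_ && _); lia.
Qed.

Lemma high_ilace D D' : (D <= D')%N -> ilace (high_sum D) (high_sum D').
Proof.
move=> leD; rewrite (high_sum_split leD); apply: ilaceDl;
  last exact: ilace_refl.
apply: ilace_sum => i j /andP[Qi le_i] /andP[Qj le_j]; apply: cc => //; lia.
Qed.

Lemma ilace_edge_asc i j : Q i -> Q j -> (ind j <= ind i)%N -> ilace (c i) (t * a j).
Proof.
move=> Qi Qj le_ji; apply: ilaceDl; first exact/ilace_flip/aa.
exact/ilace_scale/ba.
Qed.

(** Passing from D to D' moves the indices between them from the high sum, where
    they contribute Y = sum of c, to the low one, where they contribute W = sum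
    of t a.  The comparison of Y with W is not one of pairs, since [c i] and
    [t * a j] need not be related unless [ind j <= ind i]; it holds because
    Y = sum of a + t (sum of b), whose parts are each related to W. *)
Lemma high_low_ilace D D' : (D <= D')%N ->
  ilace (high_sum D + t * low_sum D) (high_sum D' + t * low_sum D').
Proof.
move=> leD; rewrite (high_sum_split leD) (low_sum_split leD) mulrDr -addrA [X in ilace _ X]addrA.
set X := t * low_sum D; set Z := high_sum D'; set Y := \sum_(i | _) c i.
set W := t * _.
have YX : ilace Y X.
  rewrite /X /low_sum mulr_sumr;
    apply: ilace_sum => i j /andP[Qi le_i] /andP[Qj le_j].
  by apply: ilace_edge_asc => //; lia.
have YZ : ilace Y Z.
  by apply: ilace_sum => i j /andP[Qi le_i] /andP[Qj le_j]; apply: cc => //;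
    lia.
have XW : ilace X W.
  by apply/ilace_scale/ilace_sum => i j /andP[Qi le_i] /andP[Qj le_j];
    apply: aa => //; lia.
have ZW : ilace Z W.
  rewrite /W mulr_sumr; apply: ilace_sum => i j /andP[Qi le_i] /andP[Qj le_j].
  by apply: ilace_edge_asc => //; lia.
have YW : ilace Y W.
  rewrite /Y /c big_split /= -mulr_sumr; apply: ilaceDl.
    exact/ilace_flip/ilace_refl.
  by apply/ilace_scale/ilace_sum => i j /andP[Qi _] /andP[Qj _]; apply: ba.
have SW : ilace (Z + X) W by apply: ilaceDl.
apply: ilaceDl; first by do 2![apply: ilaceDr => //].
by apply: ilaceDr => //; apply: ilace_refl.
Qed.

End Transfer.

Hypothesis t_notin : ~~ (t <= 0).

(** A sector with an angle less than pi contains no line. *)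
Lemma cone_pointed w w' : cone w -> cone w' -> w + w' = 0 -> w = 0.
Proof.
move=> [al [be [al0 be0 ->]]] [al' [be' [al'0 be'0 ->]]] E.
have {}E : (al + al') + (be + be') * t = 0 by rewrite -E; ring.
have be_eq0 : be + be' = 0.
  apply: contraNeq t_notin => nz; have -> : t = - ((al + al') / (be + be')).
    by move/eqP: E; rewrite addrC addr_eq0 => /eqP E;
      rewrite -mulNr -E mulrC mulKf.
  by rewrite oppr_le0 divr_ge0 ?addr_ge0.
move: E; rewrite be_eq0 mul0r addr0 => /eqP;
  rewrite paddr_eq0 // => /andP[/eqP -> _].
by move/eqP: be_eq0; rewrite paddr_eq0 // => /andP[/eqP -> _];
  rewrite mul0r addr0.
Qed.

(** Multiplying a vanishing sum by the conjugate of its first nonzero term would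
    give elements of the cone with sum 0, one of which is positive. *)
Lemma ilace_sum_neq0 (I : finType) (Q : pred I) (ind : I -> nat) (f : I -> C) i0 :
  (forall i j, Q i -> Q j -> (ind i <= ind j)%N -> ilace (f i) (f j)) ->
  Q i0 -> f i0 != 0 -> \sum_(i | Q i) f i != 0.
Proof.
move=> ff Qi0 fi0; have S0 : Q i0 && (f i0 != 0) by rewrite Qi0.
case: (@arg_minnP _ i0 (fun i => Q i && (f i != 0)) ind S0) => m /andP[Qm fm] minm.
apply/negP => /eqP sum0.
have: f m * (f m)^* + \sum_(i | (Q i && (f i != 0)) && (i != m)) f i * (f m)^* = 0.
  rewrite -(bigD1 m (P := fun i => Q i && (f i != 0))) ?Qm //= -mulr_suml.
  rewrite -[RHS](mul0r (f m)^*) -[X in _ = X * _]sum0.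
  rewrite [in RHS](bigID (fun i => f i != 0)) /=.
  by rewrite [X in _ = (_ + X) * _]big1 ?addr0 // => i /andP[_ /negbNE/eqP].
move=> /(cone_pointed (ilace_refl _)) /eqP.
rewrite mulf_eq0 conjC_eq0 orbb (negPf fm) => H; suff: false by [].
apply: H; apply: cone_sum => i /andP[Si _]; apply: ff => //;
  first by case/andP: Si.
exact: minm.
Qed.

End Cone.

(** * Rank-uniform labelings and real-rootedness *)

Section LabelIndices.

Variables (d d' : Order.disp_t) (P : finTBPOrderType d).
Variables (L : orderType d') (lam : P -> P -> L).

Lemma mem_labels_above (u w : P) : covers u w -> lam u w \in labels_above lam u.
Proof.
move=> uw; rewrite mem_sort mem_undup; apply: map_f.
by rewrite mem_filter uw mem_enum.
Qed.

(** Among the sorted labels above [u], those smaller than the label below come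
    first, so an index compared with [des] tells a descent from an ascent. *)
Lemma Ind_le_des (s u w : P) : covers u w ->
  (Ind lam u w <= des lam s u)%N = (lam u w < lam s u)%O.
Proof.
move=> /mem_labels_above uw; rewrite /Ind /des.
set l := labels_above lam u in uw *.
have sl : sorted <=%O l by apply: sort_sorted; apply: le_total.
have E := nth_index (lam u w) uw.
apply/idP/idP => [lt_i|]; first by rewrite -E; apply: nth_count_lt.
rewrite ltNge; apply: contraNT; rewrite -leqNgt => le_i.
by rewrite -[X in (_ <= X)%O]E; apply: nth_count_ge; rewrite // le_i index_mem.
Qed.

Lemma Ind_bound (u w : P) : covers u w -> (Ind lam u w < #|P|.+2)%N.
Proof.
move=> /mem_labels_above; rewrite -index_mem /Ind !ltnS => /ltnW/leq_trans;
  apply.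
rewrite size_sort (leq_trans (size_undup _)) // size_map size_filter.
by rewrite (leq_trans (count_size _ _)) // -cardE.
Qed.

Variables (rk : P -> nat).
Hypothesis unif : rank_uniform rk lam.

(** Equality of widths makes sums over the covers of two elements of the same rank
    comparable index by index. *)
Lemma uniform_sum (V : nmodType) (F F' : P -> V) (p : pred nat) (u u' : P) :
  rk u = rk u' ->
  (forall w w', covers u w -> covers u' w' -> Ind lam u w = Ind lam u' w' ->
     F w = F' w') ->
  \sum_(w | covers u w && p (Ind lam u w)) F w =
  \sum_(w | covers u' w && p (Ind lam u' w)) F' w.
Proof.
move=> rku FF'; pose N := #|P|.+1.
rewrite (partition_big (fun w => inord (Ind lam u w) : 'I_N.+1) predT) //=.
rewrite [RHS](partition_big (fun w => inord (Ind lam u' w) : 'I_N.+1) predT) //=.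
apply: eq_bigr => j _.
have classE v w : (covers v w && p (Ind lam v w)) && (inord (Ind lam v w) == j) =
    p j && (w \in [set w | covers v w && (Ind lam v w == j)]).
  rewrite inE; have [vw /=|] := boolP (covers v w); last by rewrite !andbF.
  rewrite -val_eqE /= inordK ?Ind_bound // andbC.
  by case: eqP => [->|]; rewrite ?andbT ?andbF.
rewrite (eq_bigl _ _ (classE u)) (eq_bigl _ _ (classE u')).
case: (p j); last by rewrite !big_pred0.
set S := [set w | _]; set S' := [set w | _ && (Ind lam u' w == j)].
have cardS : #|S| = #|S'|.
  have [j0|j0] := posnP j; last exact: (proj1 unif).
  rewrite /S /S' j0 !(eq_card0 (A := [set w | _])) // => w; rewrite inE.
  - by rewrite andbF.
  - by rewrite andbF.
have FS w w' : w \in S -> w' \in S' -> F w = F' w'.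
  by rewrite !inE => /andP[uw /eqP i1] /andP[uw' /eqP i2]; apply: FF';
    rewrite // i1 i2.
have [w0 w0S|S0] := pickP (mem S); last first.
  rewrite (big_pred0 _ _ _ _ S0) big_pred0 // => w.
  have : #|S'| = 0%N by rewrite -cardS; apply: eq_card0.
  by move/eqP; rewrite cards_eq0 => /eqP ->; rewrite inE.
have [w1 w1S] : exists w, w \in S'.
  by apply/card_gt0P; rewrite -cardS; apply/card_gt0P; exists w0.
rewrite /= (eq_bigr (fun=> F' w1)) => [|w wS]; last exact: FS.
rewrite [RHS](eq_bigr (fun=> F' w1)) => [|w wS];
  last by rewrite -(FS w0 w) // -(FS w0 w1).
by rewrite !sumr_const cardS.
Qed.

End LabelIndices.

Section Evaluation.

Variables (d d' : Order.disp_t) (P : finTBPOrderType d) (rk : P -> nat).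
Variables (L : orderType d') (lam : P -> P -> L) (step : P -> P -> P).
Hypotheses (rkP : rank_function rk) (stepP : rising_step lam step).
Hypotheses (unif : rank_uniform rk lam) (mono : monotonic rk lam).
Variables (C : numClosedFieldType) (z : C) (h : P -> C).
Hypothesis h_rec : forall s : P,
  h s = 1 + \sum_(u | (s < u)%O) geom z (rk u - rk s).-1 * h u.
Hypothesis z_notin : ~~ (z <= 0).

Let kappa := 1 + z.
Let t := z / kappa ^+ 2.

Lemma kappa_neq0 : kappa != 0.
Proof.
apply: contraNneq z_notin => k0; rewrite -[z](addKr 1) -/kappa k0 addr0.
by rewrite lerN10.
Qed.

Lemma zE : z = t * kappa ^+ 2.
Proof. by rewrite /t divfK // expf_neq0 // kappa_neq0. Qed.

Lemma t_neq0 : t != 0.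
Proof. by apply: contraNneq z_notin => t0; rewrite zE t0 mul0r lexx. Qed.

(** For t < 0 the equation t (1 + z)^2 = z has two negative solutions: a
    non-real solution would have modulus 1, which gives t |1 + z|^2 = 1. *)
Lemma t_notin : ~~ (t <= 0).
Proof.
apply: contraNN z_notin => t_le0.
have t_real : t^* = t by apply/CrealP; rewrite -realN ger0_real // oppr_ge0.
have zc : z^* = t * (kappa^*) ^+ 2 by rewrite {1}zE rmorphM rmorphXn /= t_real.
have [zr|zn] := eqVneq z^* z.
  rewrite zE nmulr_rle0 ?lt_neqAle ?t_neq0 //.
  by rewrite real_exprn_even_ge0 // rpredD ?rpred1 //; apply/CrealP.
have kcE : kappa^* = 1 + z^* by rewrite rmorphD rmorph1.
(* [z] and its conjugate are the two roots of t X^2 + (2t - 1) X + t *)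
have prod1 : z * z^* = 1.
  have : (z - z^*) * (1 - z * z^*) = 0.
    have : z * (t * (kappa^*) ^+ 2) = z^* * (t * kappa ^+ 2) by rewrite -zc -zE mulrC.
    rewrite kcE /kappa => E; apply: (mulfI t_neq0); rewrite mulr0.
    have -> : t * ((z - z^*) * (1 - z * z^*)) =
      z * (t * (1 + z^*) ^+ 2) - z^* * (t * (1 + z) ^+ 2) by ring.
    by rewrite E subrr.
  move/eqP; rewrite mulf_eq0 !subr_eq0 [z == _]eq_sym (negPf zn) /= => /eqP //.
have sum1 : t * (kappa * kappa^*) = 1.
  have zd : z - z^* != 0 by rewrite subr_eq0 eq_sym.
  apply: (mulfI zd); rewrite mulr1.
  have -> : (z - z^*) * (t * (kappa * kappa^*)) = (z - z^*) * t * (1 + z + z^* + z * z^*).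
    by rewrite kcE /kappa; ring.
  rewrite prod1 [in RHS]zc [X in _ = X - _]zE kcE /kappa; ring.
have := mulr_le0_ge0 t_le0 (mul_conjC_ge0 kappa).
by rewrite sum1 ler10.
Qed.

(** The factor 1 + z turns the recursion into that of [high_sum] and [low_sum]
    at the point t, with a common factor 1 + z that [ilace] does not see. *)
Definition asc_val (s u : P) : C := asc_sum rk step z h s u.
Definition desc_val (s u : P) : C := kappa * desc_sum rk step z h s u.
Definition edge_val (s u : P) : C := asc_val s u + t * desc_val s u.

Lemma edge_valE s u :
  kappa * edge_val s u =
  (1 + z) * asc_sum rk step z h s u + z * desc_sum rk step z h s u.
Proof.
rewrite /edge_val /asc_val /desc_val; set A := asc_sum _ _ _ _ _ _;
  set B := desc_sum _ _ _ _ _ _.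
by rewrite [X in _ = _ + X * B]zE -/kappa; ring.
Qed.

Lemma asc_val_rec (s u : P) : covers s u -> u != \top%O ->
  asc_val s u =
    kappa * high_sum t (covers u) (Ind lam u) (asc_val u) (desc_val u) (des lam s u).
Proof.
move=> su u1; rewrite /asc_val (asc_sum_rec rkP stepP) // /high_sum mulr_sumr.
apply: eq_big => [w|w _]; last by rewrite -/(edge_val u w) edge_valE.
have [uw /=|//] := boolP (covers u w).
by rewrite [RHS]ltnNge Ind_le_des // -leNgt.
Qed.

Lemma desc_val_rec (s u : P) : covers s u -> u != \top%O ->
  desc_val s u = kappa * low_sum (covers u) (Ind lam u) (asc_val u) (des lam s u).
Proof.
move=> su u1; rewrite /desc_val (desc_sum_rec rkP stepP h_rec) // /low_sum;
  congr (_ * _).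
apply: eq_bigl => w; have [uw /=|//] := boolP (covers u w).
by rewrite Ind_le_des.
Qed.

Lemma edge_val_rec (s u : P) : covers s u -> u != \top%O ->
  edge_val s u = kappa *
    (high_sum t (covers u) (Ind lam u) (asc_val u) (desc_val u) (des lam s u) +
     t * low_sum (covers u) (Ind lam u) (asc_val u) (des lam s u)).
Proof.
by move=> su u1; rewrite /edge_val asc_val_rec // desc_val_rec //; ring.
Qed.

Lemma vals_top (s : P) : covers s \top%O ->
  asc_val s \top%O = 1 /\ desc_val s \top%O = 0.
Proof.
move=> s1; rewrite /asc_val /desc_val (asc_sum_top rk stepP) //.
by rewrite (desc_sum_top rkP stepP h_rec) // mulr0.
Qed.

Lemma rk_eq_top (u u' : P) : rk u = rk u' -> u = \top%O -> u' = \top%O.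
Proof.
move=> E u1; apply/eqP; rewrite -[_ == _]negbK; apply/negP => u'1.
have: (u' < \top)%O by rewrite lt_neqAle u'1 lex1.
by move/(rk_lt rkP stepP); rewrite -E u1 ltnn.
Qed.

(** The invariant of the recursion, for edges whose lower ends may differ but have
    the same rank.  Its first part, which says that the values of an edge only
    depend on this rank and on the index of its label, allows all sums above [u']
    to be rewritten as sums above [u]. *)
Lemma edge_vals_ilace (s u s' u' : P) :
  covers s u -> covers s' u' -> rk u = rk u' ->
  [/\ Ind lam s u = Ind lam s' u' ->
        asc_val s u = asc_val s' u' /\ desc_val s u = desc_val s' u',
      ilace t (desc_val s u) (asc_val s' u') &
      (Ind lam s u <= Ind lam s' u')%N ->
        ilace t (asc_val s u) (asc_val s' u') /\
        ilace t (edge_val s u) (edge_val s' u')].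
Proof.
elim/(@gt_ind _ P): u s s' u' => u IH s s' u' su su' rku.
have rks : rk s = rk s' by move: rku;
  rewrite (rk_covers rkP su) (rk_covers rkP su') => -[].
have [u1|u1] := eqVneq u \top%O.
  have u'1 := rk_eq_top rku u1; rewrite {}u1 {}u'1 in su su' *.
  have [eas ebs] := vals_top su; have [eas' ebs'] := vals_top su'.
  rewrite /edge_val eas ebs eas' ebs'; split=> // [|_].
    by rewrite /ilace rmorph0 mulr0; apply: cone_ge0.
  by split; apply: ilace_refl.
have u'1 : u' != \top%O by apply: contra_neq u1 => u'1; apply: rk_eq_top u'1.
have same w w' : covers u w -> covers u' w' -> Ind lam u w = Ind lam u' w' ->
    asc_val u w = asc_val u' w' /\ desc_val u w = desc_val u' w'.
  move=> uw uw'; have [|// + _ _] := IH w (covers_lt uw) u u' w' uw uw'.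
  by rewrite (rk_covers rkP uw) (rk_covers rkP uw') rku.
have lowE D : low_sum (covers u') (Ind lam u') (asc_val u') D =
    low_sum (covers u) (Ind lam u) (asc_val u) D.
  apply/esym/(uniform_sum unif (fun i => (i <= D)%N)) => // w w' uw uw' /same.
  by case.
have highE D : high_sum t (covers u') (Ind lam u') (asc_val u') (desc_val u') D =
    high_sum t (covers u) (Ind lam u) (asc_val u) (desc_val u) D.
  apply/esym/(uniform_sum unif (fun i => (D < i)%N)) => // w w' uw uw' /same.
  by case=> // -> ->.
have ba i j : covers u i -> covers u j -> ilace t (desc_val u i) (asc_val u j).
  move=> ui uj; have [|//] := IH i (covers_lt ui) u u j ui uj.
  by rewrite (rk_covers rkP ui) (rk_covers rkP uj).
have acc i j : covers u i -> covers u j -> (Ind lam u i <= Ind lam u j)%N ->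
    ilace t (asc_val u i) (asc_val u j) /\ ilace t (edge_val u i) (edge_val u j).
  move=> ui uj; have [|//] := IH i (covers_lt ui) u u j ui uj.
  by rewrite (rk_covers rkP ui) (rk_covers rkP uj).
have aa i j ui uj le_ij := (@acc i j ui uj le_ij).1.
have cc i j ui uj le_ij := (@acc i j ui uj le_ij).2.
split.
- move=> eqI; rewrite !asc_val_rec // !desc_val_rec // lowE highE.
  by rewrite (proj2 unif _ _ _ _ su su' rks eqI).
- by rewrite asc_val_rec // desc_val_rec // highE;
    apply/ilace_scale/low_high_ilace.
- move=> leI; have leD : (des lam s u <= des lam s' u')%N.
    have rkt : (rk s < rk \top%O)%N.
      by apply: (rk_lt rkP stepP); apply: lt_le_trans (covers_lt su) (lex1 _).
    exact: (mono rkt su su').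
  rewrite !asc_val_rec // !edge_val_rec // lowE highE; split;
    apply: ilace_scale.
    exact: high_ilace.
  exact: high_low_ilace.
Qed.

Lemma desc_asc_ilace (u w w' : P) : covers u w -> covers u w' ->
  ilace t (desc_val u w) (asc_val u w').
Proof.
move=> uw uw'; have [|//] := edge_vals_ilace uw uw'.
by rewrite (rk_covers rkP uw) (rk_covers rkP uw').
Qed.

Lemma asc_edge_ilace (u w w' : P) : covers u w -> covers u w' ->
  (Ind lam u w <= Ind lam u w')%N ->
  ilace t (asc_val u w) (asc_val u w') /\ ilace t (edge_val u w) (edge_val u w').
Proof.
move=> uw uw'; have [|//] := edge_vals_ilace uw uw'.
by rewrite (rk_covers rkP uw) (rk_covers rkP uw').
Qed.

(** [t * desc_val] and [asc_val] cannot cancel, as they span a sector with angle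
    less than pi. *)
Lemma edge_val_neq0 (s u : P) : covers s u ->
  (asc_val s u != 0) || (desc_val s u != 0) -> edge_val s u != 0.
Proof.
move=> su; apply: contraTneq => c0.
have a0 : asc_val s u = 0.
  have bta : cone t (t * desc_val s u * (asc_val s u)^*) by apply/ilace_flip/desc_asc_ilace.
  have : asc_val s u * (asc_val s u)^* + t * desc_val s u * (asc_val s u)^* = 0.
    by rewrite -mulrDl -/(edge_val s u) c0 mul0r.
  move/(cone_pointed t_notin (ilace_refl _ _) bta)/eqP.
  by rewrite mulf_eq0 conjC_eq0 orbb => /eqP.
move: c0; rewrite /edge_val a0 add0r => /eqP;
  rewrite mulf_eq0 (negPf t_neq0) /= => /eqP ->.
by rewrite eqxx.
Qed.

(** The sum giving [asc_val] may be empty, but not both that one and the sum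
    giving [desc_val]: the first edge of the rising chain from [u] to the
    maximum has the smallest label above [u] and belongs to one of them. *)
Lemma edge_vals_neq0 (s u : P) : covers s u ->
  edge_val s u != 0 /\ (step s \top%O = u -> asc_val s u != 0).
Proof.
elim/(@gt_ind _ P): u s => u IH s su.
have [u1|u1] := eqVneq u \top%O.
  rewrite u1 in su *; have [a1 b0] := vals_top su.
  by rewrite /edge_val a1 b0 mulr0 addr0 oner_neq0.
have lu1 : (u < \top)%O by rewrite lt_neqAle u1 lex1.
set w := step u \top%O; have uw : covers u w := step_covers stepP lu1.
have [cw /(_ erefl) aw] := IH w (covers_lt uw) u uw.
have a_neq0 : (lam s u <= lam u w)%O -> asc_val s u != 0.
  move=> le_l; rewrite asc_val_rec // mulf_neq0 ?kappa_neq0 //.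
  apply: (ilace_sum_neq0 t_notin (ind := Ind lam u) (i0 := w)) => //.
    by move=> i j /andP[ui _] /andP[uj _] /(asc_edge_ilace ui uj)[].
  by rewrite uw ltnNge Ind_le_des // -leNgt.
split; last by move=> /eqP; case: stepP => _ -> // _ /a_neq0.
apply: edge_val_neq0 => //;
  have [/a_neq0 -> //|lt_l] := leP (lam s u) (lam u w).
apply/orP; right; rewrite desc_val_rec // mulf_neq0 ?kappa_neq0 //.
apply: (ilace_sum_neq0 t_notin (ind := Ind lam u) (i0 := w)) => //.
  by move=> i j /andP[ui _] /andP[uj _] /(asc_edge_ilace ui uj)[].
by rewrite uw Ind_le_des.
Qed.

Lemma chow_val_neq0 (s : P) : h s != 0.
Proof.
have [->|s1] := eqVneq s \top%O; first by rewrite (h_top h_rec) oner_neq0.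
have ls1 : (s < \top)%O by rewrite lt_neqAle s1 lex1.
rewrite (sum_asc_sum rkP stepP h_rec) //.
have sw := step_covers stepP ls1.
apply: (ilace_sum_neq0 t_notin (ind := Ind lam s) (i0 := step s \top%O)) => //.
  by move=> i j si sj /(asc_edge_ilace si sj)[].
by have [_ ->] := edge_vals_neq0 sw.
Qed.

Lemma aug_val_neq0 (s : P) :
  \sum_(v | (s <= v)%O) z ^+ (rk v - rk s) * h v != 0.
Proof.
have [->|s1] := eqVneq s \top%O.
  by rewrite sum_ge_top subnn mul1r (h_top h_rec) oner_neq0.
have ls1 : (s < \top)%O by rewrite lt_neqAle s1 lex1.
rewrite (aug_edge_sum rkP stepP h_rec) //.
under eq_bigr do rewrite -edge_valE.
rewrite -mulr_sumr mulf_neq0 ?kappa_neq0 //.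
have sw := step_covers stepP ls1.
apply: (ilace_sum_neq0 t_notin (ind := Ind lam s) (i0 := step s \top%O)) => //.
  by move=> i j si sj /(asc_edge_ilace si sj)[].
by have [] := edge_vals_neq0 sw.
Qed.

End Evaluation.

Lemma chow_eval_rec (d : Order.disp_t) (P : finTBPOrderType d) (rk : P -> nat)
    (C : numClosedFieldType) (z : C) (s : P) :
  (forall s u : P, (s < u)%O -> (rk s < rk u)%N) ->
  let h u := (map_poly intr (chow_up rk u)).[z] in
  h s = 1 + \sum_(u | (s < u)%O) geom z (rk u - rk s).-1 * h u.
Proof.
move=> rk_lt h; rewrite /h chow_up_rec // rmorphD rmorph1 hornerD hornerC.
rewrite rmorph_sum horner_sum; congr (_ + _); apply: eq_bigr => u _.
rewrite rmorphM hornerM; congr (_ * _).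
rewrite /geom rmorph_sum horner_sum; apply: eq_bigr => i _ /=.
by rewrite map_polyXn hornerXn.
Qed.

Theorem theorem1p2 (d : Order.disp_t) (P : finTBPOrderType d) (rk : P -> nat)
    (R : rcfType) :
  rank_function rk -> UMEL_shellable rk ->
  only_real_nonpos_roots R (chow_poly rk) /\
  only_real_nonpos_roots R (aug_chow_poly rk).
Proof.
move=> rkP [d' [L [lam [/EL_rising_step [step stepP] unif mono]]]].
have eval_rec z s := @chow_eval_rec _ P rk R[i] z s (rk_lt rkP stepP).
have nonpos (z : R[i]) : z <= 0 -> complex.Im z = 0 /\ complex.Re z <= 0.
  by rewrite lecE => /andP[/eqP <- ->].
split=> z /rootP pz; apply: nonpos; apply: contra_eqT pz => z_notin.
  exact: (chow_val_neq0 rkP stepP unif mono (eval_rec z) z_notin).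
rewrite /aug_chow_poly rmorph_sum horner_sum.
under eq_bigr do rewrite rmorphM hornerM /= map_polyXn hornerXn.
have := aug_val_neq0 rkP stepP unif mono (eval_rec z) z_notin \bot%O.
congr (_ != 0); apply: eq_big => [u|u _]; first by rewrite le0x.
by rewrite (proj1 rkP) subn0.
Qed.
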